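(* Let $(A,L)$ be an $LR_\infty[1]$ algebra, $\mathcal A$ an associative, graded commutative, unital $A$-algebra, $\nabla$ an action of $(A,L)$ on $\mathcal A$, and $\mathcal P$ a graded $\mathcal A$-module. Then left derivative pre-representations of $(A,L)$ on $\mathcal P$ subordinate to $\nabla$ are equivalent to left $(\mathcal A,\mathcal A\otimes_AL)$-connections in $\mathcal P$; that is, restriction of structure maps along $L\to\mathcal A\otimes_AL$, $\xi\mapsto1\otimes\xi$, is a bijection from left $(\mathcal A,\mathcal A\otimes_AL)$-connections in $\mathcal P$ to left derivative pre-representations of $(A,L)$ on $\mathcal P$ subordinate to $\nabla$ (with inverse given by extension by $\mathcal A$-linearity).
   Context: Conventions: $K$ is a field of characteristic $0$; graded means $\mathbb Z$-graded; $\bar v$ is the degree of a homogeneous element or map $v$, and bars are omitted in exponents of signs: $(-)^{v}=(-1)^{\bar v}$, $(-)^{vw}=(-1)^{\bar v\bar w}$. $S_{\ell,m}$ is the set of $(\ell,m)$-unshuffles, i.e. permutations $\pi$ of $\{1,\dots,\ell+m\}$ with $\pi(1)<\cdots<\pi(\ell)$ and $\pi(\ell+1)<\cdots<\pi(\ell+m)$ (sums over $S_{\ell,m}$ with $\ell<0$ or $m<0$ are zero). $\alpha(\pi,\boldsymbol v)$ is the Koszul sign: $v_{\pi(1)}\odot\cdots\odot v_{\pi(n)}=\alpha(\pi,\boldsymbol v)\,v_1\odot\cdots\odot v_n$ in the graded symmetric algebra. Multilinearity over a graded algebra and graded symmetry use the Koszul sign rule. $LR_\infty[1]$ algebra: let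 $A$ be an associative, graded commutative, unital $K$-algebra and $L$ a graded $A$-module. An $LR_\infty[1]$ algebra structure on $(A,L)$ is a degree $1$ multiderivation $\mathbb X=\mathbb X_1+\mathbb X_2+\cdots$ (formal infinite sum, no $0$-entry component), $\mathbb X_k=(X_k,\sigma_k)$, where $X_k:L^{\times k}\to L$ is graded symmetric, $K$-multilinear, of degree $1$, and $\sigma_k:L^{\times(k-1)}\to\mathrm{Der}A$ is graded symmetric, $A$-multilinear, of degree $1$ (write $\sigma_k(\xi_1,\dots,\xi_{k-1}|a)$ for $\sigma_k(\xi_1,\dots,\xi_{k-1})(a)$), with $$X_k(\xi_1,\dots,\xi_{k-1},a\xi_k)=\sigma_k(\xi_1,\dots,\xi_{k-1}|a)\,\xi_k+(-)^{(1+\xi_1+\cdots+\xi_{k-1})a}a\,X_k(\xi_1,\dots,\xi_k),$$ and such that for all $k$: (J1) $\sum_{i+j=k}\sum_{\pi\in S_{i,j}}\alpha(\pi,\boldsymbol\xi)X_{j+1}(X_i(\xi_{\pi(1)},\dots,\xi_{\pi(i)}),\xi_{\pi(i+1)},\dots,\xi_{\pi(i+j)})=0$, and (J2) $\sum_{i+j=k}\sum_{\pi\in S_{i,j-1}}\alpha(\pi,\boldsymbol\xi)\big[\sigma_{j+1}(X_i(\xi_{\pi(1)},\dots,\xi_{\pi(i)}),\xi_{\pi(i+1)},\dots,\xi_{\pi(k-1)}|a)+(-)^{\xi_{\pi(1)}+\cdots+\xi_{\pi(i)}}\sigma_{i+1}(\xi_{\pi(1)},\dots,\xi_{\pi(i)}|\sigma_j(\xi_{\pi(i+1)},\dots,\xi_{\pi(k-1)}|a))\big]=0$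 (with $X_0=0$). Left connection: a left $(A,L)$-connection in a graded $A$-module $P$ is $\nabla=\nabla_1+\nabla_2+\cdots$, with $\nabla_k:L^{\times(k-1)}\to\mathrm{End}_KP$ graded symmetric, $A$-multilinear (for the $A$-module structure $(a\phi)(p)=a\phi(p)$), of degree $1$, with $\nabla_k(\xi_1,\dots,\xi_{k-1}|ap)=(-)^{(1+\xi_1+\cdots+\xi_{k-1})a}a\nabla_k(\xi_1,\dots,\xi_{k-1}|p)+\sigma_k(\xi_1,\dots,\xi_{k-1}|a)p$. It is flat if its curvature $$J(\nabla)(\xi_1,\dots,\xi_{k-1}|p)=\sum_{i+j=k}\sum_{\pi\in S_{i,j-1}}\alpha(\pi,\boldsymbol\xi)\big[\nabla_{j+1}(X_i(\xi_{\pi(1)},\dots,\xi_{\pi(i)}),\xi_{\pi(i+1)},\dots,\xi_{\pi(k-1)}|p)+(-)^{\xi_{\pi(1)}+\cdots+\xi_{\pi(i)}}\nabla_{i+1}(\xi_{\pi(1)},\dots,\xi_{\pi(i)}|\nabla_j(\xi_{\pi(i+1)},\dots,\xi_{\pi(k-1)}|p))\big]$$ vanishes for all $k\ge1$. Actions: a pre-action of $(A,L)$ on $\mathcal A$ (a graded algebra extension $A\subset\mathcal A$) is a left $(A,L)$-connection $\nabla$ in $\mathcal A$ such that every $\nabla_k(\xi_1,\dots,\xi_{k-1})$ is a graded derivation of the algebra $\mathcal A$; an action is a flat pre-action. An action $\nabla$ determines an $LR_\infty[1]$ algebra structure $(Y_k,\tilde\sigma_k)_k$ on $(\mathcal A,\mathcal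 A\otimes_AL)$ (the transformation $LR_\infty[1]$ algebra): $\tilde\sigma_k:(\mathcal A\otimes_AL)^{\times(k-1)}\to\mathrm{Der}\mathcal A$ is the $\mathcal A$-multilinear extension of $\nabla_k:L^{\times(k-1)}\to\mathrm{Der}\mathcal A$, and $Y_k$ is the unique $K$-multilinear graded symmetric map with $Y_k(1\otimes\xi_1,\dots,1\otimes\xi_k)=1\otimes X_k(\xi_1,\dots,\xi_k)$ satisfying the Leibniz rule with symbol $\tilde\sigma_k$. Left $(\mathcal A,\mathcal A\otimes_AL)$-connections are with respect to this structure. Left derivative pre-representation of $(A,L)$ on $\mathcal P$ subordinate to $\nabla$: a left $(A,L)$-connection $\nabla^{\mathcal P}$ in $\mathcal P$ such that $$\nabla^{\mathcal P}(\xi_1,\dots,\xi_{k-1}|fp)=(-)^{(\xi_1+\cdots+\xi_{k-1}+1)f}f\,\nabla^{\mathcal P}(\xi_1,\dots,\xi_{k-1}|p)+\nabla(\xi_1,\dots,\xi_{k-1}|f)\,p$$ for all $k$, $\xi_i\in L$, $f\in\mathcal A$, $p\in\mathcal P$. *)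

(* Defs.v *)
From HB Require Import structures.
From mathcomp Require Import all_boot all_order all_algebra perm.
From mathcomp Require Import boolp classical_sets functions.

Set Implicit Arguments.
Unset Strict Implicit.
Unset Printing Implicit Defensive.

Import GRing.Theory.
Local Open Scope ring_scope.
Local Open Scope quotient_scope.

(* Internal Z-gradings: [homog i v] means that v lies in the degree i summand,
   so 0 is homogeneous of every degree. *)
Record grading (V : zmodType) := Grading {
  homog :> int -> V -> Prop;
  homog0 : forall i, homog i 0;
  homogB : forall i u v, homog i u -> homog i v -> homog i (u - v);
  homog_gen : forall v, exists (s : seq int) (c : int -> V),
    (forall i, homog i (c i)) /\ v = \sum_(i <- s) c i;
  homog_free : forall (s : seq int) (c : int -> V), uniq s ->
    (forall i, homog i (c i)) -> \sum_(i <- s) c i = 0 ->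
    forall i, i \in s -> c i = 0 }.

Section GradingTheory.
Variables (V : zmodType) (g : grading V).

Lemma homogN i v : g i v -> g i (- v).
Proof. by move=> gv; rewrite -sub0r; apply: homogB => //; apply: homog0. Qed.

Lemma homogD i u v : g i u -> g i v -> g i (u + v).
Proof. by move=> gu gv; rewrite -[v]opprK; apply: homogB => //; apply: homogN. Qed.

Lemma homog_sum i (I : Type) (r : seq I) (F : I -> V) :
  (forall j, g i (F j)) -> g i (\sum_(j <- r) F j).
Proof.
by move=> gF; elim/big_ind: _ => //; [exact: homog0 | move=> *; exact: homogD].
Qed.

(* Homogeneous elements generate: additive identities may be checked on them. *)
Lemma homog_ind (P : V -> Prop) :
  (forall u v, P u -> P v -> P (u + v)) ->
  (forall i v, g i v -> P v) -> forall v, P v.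
Proof.
move=> PD Ph v; have [s [c [gc ->]]] := homog_gen g v.
elim/big_ind: _ => //; first exact: (Ph 0 0 (homog0 g 0)).
by move=> i _; apply: (Ph i).
Qed.

Lemma homog_gen_uniq v : exists sc : seq int * (int -> V),
  [/\ uniq sc.1, forall i, g i (sc.2 i), forall i, i \notin sc.1 -> sc.2 i = 0
    & v = \sum_(i <- sc.1) sc.2 i].
Proof.
have [s [c [gc ->]]] := homog_gen g v.
exists (undup s, fun i => c i *+ count_mem i s); split => /=.
- exact: undup_uniq.
- by move=> i; elim: (count_mem i s) => [|n IH];
    rewrite ?mulr0n ?mulrS; [exact: homog0 | apply: homogD].
- move=> i; rewrite mem_undup => /count_memPn ->.
  by rewrite mulr0n.
- by rewrite -big_undup_iterop_count.
Qed.

Definition supp v : seq int := (sval (cid (homog_gen_uniq v))).1.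
Definition comp v : int -> V := (sval (cid (homog_gen_uniq v))).2.

Lemma supp_uniq v : uniq (supp v).
Proof. by case: (svalP (cid (homog_gen_uniq v))). Qed.
Lemma homog_comp v i : g i (comp v i).
Proof. by case: (svalP (cid (homog_gen_uniq v))). Qed.
Lemma comp_out v i : i \notin supp v -> comp v i = 0.
Proof. by case: (svalP (cid (homog_gen_uniq v))) => _ _ h _; apply: h. Qed.
Lemma comp_sum v : v = \sum_(i <- supp v) comp v i.
Proof. by case: (svalP (cid (homog_gen_uniq v))). Qed.

Lemma comp_sumW v (s : seq int) (W : zmodType) (F : int -> V -> W) :
  uniq s -> {subset supp v <= s} -> (forall i, F i 0 = 0) ->
  \sum_(i <- supp v) F i (comp v i) = \sum_(i <- s) F i (comp v i).
Proof.
move=> us sub F0.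
rewrite [RHS](bigID (fun i => i \in supp v)) /= [X in _ = _ + X]big1 ?addr0.
  rewrite -[RHS]big_filter; apply: perm_big; apply: uniq_perm.
  - exact: supp_uniq.
  - exact: filter_uniq.
  - move=> i; rewrite mem_filter; apply/idP/andP => [h|[]//]; split=> //.
    exact: sub.
by move=> i /comp_out ->; rewrite F0.
Qed.

Lemma comp_unique v (s : seq int) c : (forall i, g i (c i)) ->
  uniq s -> (forall i, i \notin s -> c i = 0) ->
  v = \sum_(i <- s) c i -> forall i, comp v i = c i.
Proof.
move=> gc us c0 vE.
set t := undup (s ++ supp v).
have ut : uniq t by exact: undup_uniq.
have E1 : v = \sum_(i <- t) c i.
  rewrite [RHS](bigID (fun i => i \in s)) /= [X in _ = _ + X]big1 ?addr0.
    rewrite {1}vE -[RHS]big_filter; apply: perm_big; apply: uniq_perm => //.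
      exact: filter_uniq.
    move=> i; rewrite mem_filter mem_undup mem_cat.
    by case: (i \in s).
  by move=> i /c0.
have E2 : v = \sum_(i <- t) comp v i.
  rewrite {1}[v]comp_sum; apply: (comp_sumW (F := fun _ x => x)) => // i h.
  by rewrite mem_undup mem_cat h orbT.
move=> i; case: (boolP (i \in t)) => it; last first.
  move: it; rewrite mem_undup mem_cat negb_or => /andP[h1 h2].
  by rewrite c0 // comp_out.
apply/eqP; rewrite -subr_eq0; apply/eqP.
apply: (@homog_free _ g t (fun i => comp v i - c i)) => //.
  by move=> j; apply: homogB => //; apply: homog_comp.
by rewrite sumrB -E1 -E2 subrr.
Qed.

Lemma compD u v i : comp (u + v) i = comp u i + comp v i.
Proof.
apply: (@comp_unique _ (undup (supp u ++ supp v)) (fun i => comp u i + comp v i)).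
- by move=> j; apply: homogD; apply: homog_comp.
- exact: undup_uniq.
- move=> j; rewrite mem_undup mem_cat negb_or => /andP[h1 h2].
  by rewrite !comp_out // addr0.
rewrite big_split /= {1}[u]comp_sum {1}[v]comp_sum; congr (_ + _).
  apply: (comp_sumW (F := fun _ x => x)); rewrite ?undup_uniq // => j h.
  by rewrite mem_undup mem_cat h.
apply: (comp_sumW (F := fun _ x => x)); rewrite ?undup_uniq // => j h.
by rewrite mem_undup mem_cat h orbT.
Qed.

Lemma comp_homog i v j : g i v -> comp v j = if j == i then v else 0.
Proof.
move=> gv; apply: (@comp_unique _ [:: i] (fun j => if j == i then v else 0)) => //.
- by move=> k; case: eqP => [->|_] //; apply: homog0.
- by move=> k; rewrite inE => /negPf ->.
- by rewrite big_seq1 eqxx.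
Qed.

End GradingTheory.

(* Graded commutative unital associative K-algebras.  [algType] excludes the
   zero ring, so the K-algebra structure is given by its unit map K -> A; the
   image of K is central by graded commutativity. *)
Record gcAlg (K : fieldType) := GcAlg {
  gcsort :> pzRingType;
  gcunit : {rmorphism K -> gcsort};
  gcgrad : grading gcsort;
  gcunit_homog : forall k, gcgrad 0 (gcunit k);
  gcM_homog : forall i j a b,
    gcgrad i a -> gcgrad j b -> gcgrad (i + j) (a * b);
  gc_comm : forall i j a b,
    gcgrad i a -> gcgrad j b -> a * b = (b * a) *~ (-1) ^ (i * j) }.

Record gMod (K : fieldType) (A : gcAlg K) := GMod {
  gmsort :> lmodType A;
  gmgrad : grading gmsort;
  gmZ_homog : forall i j a x,
    gcgrad A i a -> gmgrad j x -> gmgrad (i + j) (a *: x) }.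

(* Degree-preserving K-algebra morphisms: they make B a graded A-algebra. *)
Record gcHom (K : fieldType) (A B : gcAlg K) := GcHom {
  gchom :> {rmorphism A -> B};
  gchom_unit : forall k, gchom (gcunit A k) = gcunit B k;
  gchom_homog : forall i a, gcgrad A i a -> gcgrad B i (gchom a) }.

Definition regMod (K : fieldType) (A : gcAlg K) : gMod A :=
  @GMod K A A^o (gcgrad A) (@gcM_homog K A).

Definition restr_type (A B : pzRingType) (phi : {rmorphism A -> B})
  (P : lmodType B) : Type := P.

Section RestrictionOfScalars.
Variables (A B : pzRingType) (phi : {rmorphism A -> B}) (P : lmodType B).

HB.instance Definition _ := GRing.Zmodule.on (restr_type phi P).

Definition restr_scale (a : A) (p : restr_type phi P) : restr_type phi P :=
  phi a *: (p : P).

Lemma restr_scaleA a b v : restr_scale a (restr_scale b v) = restr_scale (a * b) v.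
Proof. by rewrite /restr_scale rmorphM scalerA. Qed.
Lemma restr_scale1 : left_id 1 restr_scale.
Proof. by move=> v; rewrite /restr_scale rmorph1 scale1r. Qed.
Lemma restr_scaleDr : right_distributive restr_scale +%R.
Proof. by move=> a u v; rewrite /restr_scale scalerDr. Qed.
Lemma restr_scaleDl v : {morph restr_scale^~ v : a b / a + b}.
Proof. by move=> a b; rewrite /restr_scale rmorphD scalerDl. Qed.

HB.instance Definition _ := GRing.Zmodule_isLmodule.Build A (restr_type phi P)
  restr_scaleA restr_scale1 restr_scaleDr restr_scaleDl.
End RestrictionOfScalars.

Definition restr (K : fieldType) (A B : gcAlg K) (phi : gcHom A B)
    (P : gMod B) : gMod A :=
  @GMod K A (restr_type phi P) (gmgrad P)
    (fun i j a x ha hx => gmZ_homog (gchom_homog phi ha) hx).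

(* A list of pairs stands for the formal sum of the b (x) x; the congruence is
   generated by the relations of the tensor product of the right A-module B,
   b.a = b * phi a, with the left A-module L. *)
Inductive tens_eq (A B : pzRingType) (phi : {rmorphism A -> B}) (L : lmodType A) :
  seq (B * L) -> seq (B * L) -> Prop :=
| tens_refl s : tens_eq phi s s
| tens_sym s t : tens_eq phi s t -> tens_eq phi t s
| tens_trans s t u : tens_eq phi s t -> tens_eq phi t u -> tens_eq phi s u
| tens_cat s s' t t' :
    tens_eq phi s s' -> tens_eq phi t t' -> tens_eq phi (s ++ t) (s' ++ t')
| tens_catC s t : tens_eq phi (s ++ t) (t ++ s)
| tens_Dl b b' x : tens_eq phi [:: (b + b', x)] [:: (b, x); (b', x)]
| tens_Dr b x x' : tens_eq phi [:: (b, x + x')] [:: (b, x); (b, x')]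
| tens_0 x : tens_eq phi [:: (0, x)] [::]
| tens_bal b a x : tens_eq phi [:: (b * phi a, x)] [:: (b, a *: x)].

Section ExtensionOfScalars.
Variables (A B : pzRingType) (phi : {rmorphism A -> B}) (L : lmodType A).
Local Notation teq := (@tens_eq A B phi L).

Definition tens_eqb (s t : seq (B * L)) : bool := `[< teq s t >].

Lemma tens_eqb_refl : reflexive tens_eqb.
Proof. by move=> s; apply/asboolP; apply: tens_refl. Qed.
Lemma tens_eqb_sym : symmetric tens_eqb.
Proof. by move=> s t; apply/asboolP/asboolP; apply: tens_sym. Qed.
Lemma tens_eqb_trans : transitive tens_eqb.
Proof. by move=> s t u /asboolP h /asboolP k; apply/asboolP/(tens_trans h k). Qed.

Canonical tens_equiv := EquivRel tens_eqb tens_eqb_refl tens_eqb_sym tens_eqb_trans.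

Definition tens : Type := {eq_quot tens_equiv}.
HB.instance Definition _ := Choice.on tens.
HB.instance Definition _ := Quotient.on tens.

Definition tens_pi (s : seq (B * L)) : tens := \pi_(tens) s.

Lemma tens_piP s t : reflect (tens_pi s = tens_pi t) (tens_eqb s t).
Proof. by apply: (iffP idP) => [/eqmodP//|/eqmodP]. Qed.

Lemma tens_piE s t : tens_pi s = tens_pi t <-> teq s t.
Proof. by split=> [/tens_piP/asboolP|h]; last exact/tens_piP/asboolP. Qed.

Lemma tens_piW (P : tens -> Prop) : (forall s, P (tens_pi s)) -> forall t, P t.
Proof. by move=> h t; rewrite -[t]reprK; apply: h. Qed.

Lemma tens_repr s : teq (repr (tens_pi s)) s.
Proof. by apply/tens_piE; rewrite /tens_pi reprK. Qed.

Definition tens_map (f : B -> B) : seq (B * L) -> seq (B * L) :=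
  map (fun bx => (f bx.1, bx.2)).

Lemma teq_map (f : B -> B) s t : {morph f : b b' / b + b'} ->
  (forall b a, f (b * phi a) = f b * phi a) ->
  teq s t -> teq (tens_map f s) (tens_map f t).
Proof.
move=> fD fM; elim=> {s t} /=.
- by move=> s; apply: tens_refl.
- by move=> s t _; apply: tens_sym.
- by move=> s t u _ h _ k; apply: tens_trans h k.
- by move=> s s' t t' _ h _ k; rewrite /tens_map !map_cat; apply: tens_cat.
- by move=> s t; rewrite /tens_map !map_cat; apply: tens_catC.
- by move=> b b' x; rewrite fD; apply: tens_Dl.
- by move=> b x x'; apply: tens_Dr.
- move=> x; have -> : f 0 = 0 by apply: (addrI (f 0)); rewrite -fD !addr0.
  exact: tens_0.
- by move=> b a x; rewrite fM; apply: tens_bal.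
Qed.

Definition tens_add (t u : tens) : tens := tens_pi (repr t ++ repr u).
Definition tens_zero : tens := tens_pi [::].
Definition tens_opp (t : tens) : tens := tens_pi (tens_map -%R (repr t)).
Definition tens_scale (c : B) (t : tens) : tens :=
  tens_pi (tens_map ( *%R c) (repr t)).

Lemma tens_addE s t : tens_add (tens_pi s) (tens_pi t) = tens_pi (s ++ t).
Proof. by apply/tens_piE; apply: tens_cat; apply: tens_repr. Qed.
Lemma tens_oppE s : tens_opp (tens_pi s) = tens_pi (tens_map -%R s).
Proof.
apply/tens_piE; apply: teq_map (tens_repr s) => [b b'|b a].
  by rewrite opprD.
by rewrite mulNr.
Qed.
Lemma tens_scaleE c s : tens_scale c (tens_pi s) = tens_pi (tens_map ( *%R c) s).
Proof.
apply/tens_piE; apply: teq_map (tens_repr s) => [b b'|b a].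
  by rewrite mulrDr.
by rewrite mulrA.
Qed.

Lemma tens_addA : associative tens_add.
Proof.
elim/tens_piW=> s; elim/tens_piW=> t; elim/tens_piW=> u.
by rewrite !tens_addE catA.
Qed.
Lemma tens_addC : commutative tens_add.
Proof.
elim/tens_piW=> s; elim/tens_piW=> t.
by rewrite !tens_addE; apply/tens_piE; apply: tens_catC.
Qed.
Lemma tens_add0 : left_id tens_zero tens_add.
Proof. by elim/tens_piW=> s; rewrite tens_addE. Qed.
Lemma tens_addN : left_inverse tens_zero tens_opp tens_add.
Proof.
elim/tens_piW=> s; rewrite tens_oppE tens_addE; apply/tens_piE.
elim: s => [|[b x] s IH] /=; first exact: tens_refl.
set u := tens_map _ s.
apply: (@tens_trans _ _ _ _ _ ([:: (- b, x); (b, x)] ++ (u ++ s))).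
  apply: (@tens_cat _ _ _ _ [:: _] [:: _]); first exact: tens_refl.
  rewrite -[(b, x) :: s]cat1s -[(b, x) :: _ ++ _]cat1s !catA.
  by apply: tens_cat; [apply: tens_catC | apply: tens_refl].
rewrite -[X in teq _ X]cat0s; apply: tens_cat IH.
apply: (tens_trans (tens_sym (tens_Dl _ _ _ _))).
by rewrite addNr; apply: tens_0.
Qed.

HB.instance Definition _ :=
  GRing.isZmodule.Build tens tens_addA tens_addC tens_add0 tens_addN.

Lemma tens_piD s t : tens_pi s + tens_pi t = tens_pi (s ++ t).
Proof. exact: tens_addE. Qed.

Lemma tens_scaleA a b v : tens_scale a (tens_scale b v) = tens_scale (a * b) v.
Proof.
elim/tens_piW: v => s; rewrite !tens_scaleE /tens_map -map_comp.
by congr tens_pi; apply: eq_map => -[c x] /=; rewrite mulrA.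
Qed.
Lemma tens_scale1 : left_id 1 tens_scale.
Proof.
elim/tens_piW=> s; rewrite tens_scaleE; congr tens_pi.
by elim: s => [|[b x] s /= ->] //; rewrite mul1r.
Qed.
Lemma tens_scaleDr : right_distributive tens_scale +%R.
Proof.
move=> c; elim/tens_piW=> s; elim/tens_piW=> t.
by rewrite !(tens_piD, tens_scaleE) /tens_map map_cat.
Qed.
Lemma tens_scaleDl v : {morph tens_scale^~ v : a b / a + b}.
Proof.
move=> c c'; elim/tens_piW: v => s.
rewrite !(tens_piD, tens_scaleE); apply/tens_piE.
elim: s => [|[b x] s IH] /=; first exact: tens_refl.
rewrite mulrDl -[X in teq X _]cat1s.
apply: (@tens_trans _ _ _ _ _ _ _ (tens_cat (tens_Dl _ _ _ _) IH)).
set u := tens_map _ s; set w := tens_map _ s.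
apply: (@tens_cat _ _ _ _ [:: _] [:: _]); first exact: tens_refl.
change (teq (([:: (c' * b, x)] ++ u) ++ w) (u ++ ([:: (c' * b, x)] ++ w))).
rewrite [X in teq _ X]catA.
by apply: tens_cat; [apply: tens_catC | apply: tens_refl].
Qed.

HB.instance Definition _ := GRing.Zmodule_isLmodule.Build B tens
  tens_scaleA tens_scale1 tens_scaleDr tens_scaleDl.

Definition pure (b : B) (x : L) : tens := tens_pi [:: (b, x)].

Lemma pureDl x : {morph pure^~ x : b b' / b + b'}.
Proof.
by move=> b b'; rewrite [RHS]tens_piD; apply/tens_piE; apply: tens_Dl.
Qed.
Lemma pureDr b : {morph pure b : x x' / x + x'}.
Proof.
by move=> x x'; rewrite [RHS]tens_piD; apply/tens_piE; apply: tens_Dr.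
Qed.
Lemma pure_bal b a x : pure (b * phi a) x = pure b (a *: x).
Proof. by apply/tens_piE; apply: tens_bal. Qed.
Lemma pureZ c b x : c *: pure b x = pure (c * b) x.
Proof. exact: tens_scaleE. Qed.

Lemma tens_pi_sum s : tens_pi s = \sum_(bx <- s) pure bx.1 bx.2.
Proof.
elim: s => [|[b x] s IH]; first by rewrite big_nil.
by rewrite big_cons -IH [RHS]tens_piD.
Qed.

Lemma tens_ind (P : tens -> Prop) : P 0 -> (forall t u, P t -> P u -> P (t + u)) ->
  (forall b x, P (pure b x)) -> forall t, P t.
Proof.
move=> P0 PD Pp; elim/tens_piW=> s; rewrite tens_pi_sum.
by elim/big_ind: _ => // -[b x] _.
Qed.

Section UniversalProperty.
Variables (W : zmodType) (h : B -> L -> W).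
Hypothesis hDl : forall x, {morph h^~ x : b b' / b + b'}.
Hypothesis hDr : forall b, {morph h b : x x' / x + x'}.
Hypothesis hbal : forall b a x, h (b * phi a) x = h b (a *: x).

Definition tens_lift (t : tens) : W := \sum_(bx <- repr t) h bx.1 bx.2.

Lemma tens_lift_pi s : tens_lift (tens_pi s) = \sum_(bx <- s) h bx.1 bx.2.
Proof.
suff E t u : teq t u ->
    \sum_(bx <- t) h bx.1 bx.2 = \sum_(bx <- u) h bx.1 bx.2.
  exact: E (tens_repr s).
elim=> {s t u} //=.
- by move=> s t u _ -> _ ->.
- by move=> s s' t t' _ h1 _ h2; rewrite !big_cat /= h1 h2.
- by move=> s t; rewrite !big_cat /= addrC.
- by move=> b b' x; rewrite !big_cons !big_nil /= hDl !addr0.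
- by move=> b x x'; rewrite !big_cons !big_nil /= hDr !addr0.
- move=> x; rewrite big_seq1 big_nil /=.
  by apply: (addrI (h 0 x)); rewrite -hDl !addr0.
- by move=> b a x; rewrite !big_seq1 /= hbal.
Qed.

Lemma tens_lift_pure b x : tens_lift (pure b x) = h b x.
Proof. by rewrite tens_lift_pi big_seq1. Qed.

Lemma tens_liftD : {morph tens_lift : t u / t + u}.
Proof.
elim/tens_piW=> s; elim/tens_piW=> t; rewrite tens_piD.
by rewrite !tens_lift_pi big_cat.
Qed.

End UniversalProperty.
End ExtensionOfScalars.

Section TensorGrading.
Variables (K : fieldType) (A B : gcAlg K) (phi : gcHom A B) (L : gMod A).
Local Notation T := (tens phi L).
Local Notation pure := (@pure A B phi L).

Definition tens_homog (n : int) (t : T) : Prop := exists s : seq (B * L),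
  (forall bx, bx \in s ->
     exists i j, [/\ gcgrad B i bx.1, gmgrad L j bx.2 & n = i + j]) /\
  t = \sum_(bx <- s) pure bx.1 bx.2.

Lemma pure0l x : pure 0 x = 0.
Proof. by apply: (addrI (pure 0 x)); rewrite -pureDl !addr0. Qed.
Lemma pure0r b : pure b 0 = 0.
Proof. by apply: (addrI (pure b 0)); rewrite -pureDr !addr0. Qed.
Lemma pureNl b x : pure (- b) x = - pure b x.
Proof. by apply: (addrI (pure b x)); rewrite -pureDl !addrN pure0l. Qed.

Lemma tens_homog_pure i j b x :
  gcgrad B i b -> gmgrad L j x -> tens_homog (i + j) (pure b x).
Proof.
move=> hb hx; exists [:: (b, x)]; rewrite big_seq1; split => // bx.
by rewrite inE => /eqP ->; exists i, j.
Qed.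

Lemma tens_homog0 n : tens_homog n 0.
Proof. by exists [::]; rewrite big_nil. Qed.

Lemma tens_homogB n t u : tens_homog n t -> tens_homog n u -> tens_homog n (t - u).
Proof.
move=> [s [hs ->]] [r [hr ->]].
exists (s ++ [seq (- bx.1, bx.2) | bx <- r]); split.
  move=> bx; rewrite mem_cat => /orP[/hs //|/mapP[by' /hr [i [j [h1 h2 h3]]] ->]].
  by exists i, j; split => //; apply: homogN.
rewrite big_cat big_map /=; congr (_ + _).
by rewrite -sumrN; apply: eq_bigr => bx _; rewrite pureNl.
Qed.

Lemma tens_homogD n t u : tens_homog n t -> tens_homog n u -> tens_homog n (t + u).
Proof.
move=> [s [hs ->]] [r [hr ->]]; exists (s ++ r); rewrite big_cat; split => //.
by move=> bx; rewrite mem_cat => /orP[/hs|/hr].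
Qed.

Lemma tens_homog_gen t : exists (s : seq int) (c : int -> T),
  (forall i, tens_homog i (c i)) /\ t = \sum_(i <- s) c i.
Proof.
have [l [hl ->]] : exists l : seq (int * T),
    (forall p, p \in l -> tens_homog p.1 p.2) /\ t = \sum_(p <- l) p.2.
  elim/tens_ind: t => [|t u [l [hl ->]] [m [hm ->]]|b x].
  - by exists [::]; rewrite big_nil.
  - exists (l ++ m); rewrite big_cat; split => // p.
    by rewrite mem_cat => /orP[/hl|/hm].
  exists [seq (i + j, pure (comp (gcgrad B) b i) (comp (gmgrad L) x j)) |
           i <- supp (gcgrad B) b, j <- supp (gmgrad L) x]; split.
    move=> p /allpairsP[[i j] [_ _ ->]] /=.
    by apply: tens_homog_pure; apply: homog_comp.
  rewrite big_allpairs_dep /= {1}(comp_sum (gcgrad B) b).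
  rewrite (big_morph (pure^~ x) (pureDl phi x) (pure0l x)).
  apply: eq_bigr => i _; rewrite {1}(comp_sum (gmgrad L) x).
  by rewrite (big_morph (pure _) (pureDr phi _) (pure0r _)).
exists (undup (map fst l)), (fun i => \sum_(p <- l | p.1 == i) p.2); split.
  move=> i; rewrite big_seq_cond; elim/big_ind: _.
  - exact: tens_homog0.
  - by move=> *; apply: tens_homogD.
  - by move=> p /andP[/hl h /eqP <-].
rewrite (exchange_big_dep xpredT) //= big_seq [RHS]big_seq.
apply: eq_bigr => p pl; rewrite big_mkcond (bigD1_seq p.1) ?undup_uniq //=.
  by rewrite eqxx big1 ?addr0 // => i /negPf; rewrite eq_sym => ->.
by rewrite mem_undup map_f.
Qed.

Definition pure_comp (n : int) (b : B) (x : L) : T :=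
  \sum_(i <- supp (gcgrad B) b)
    pure (comp (gcgrad B) b i) (comp (gmgrad L) x (n - i)).

Lemma pure_compW n b x s : uniq s -> {subset supp (gcgrad B) b <= s} ->
  pure_comp n b x =
  \sum_(i <- s) pure (comp (gcgrad B) b i) (comp (gmgrad L) x (n - i)).
Proof.
move=> us h; apply: (comp_sumW (F := fun i b => pure b _) us h) => i.
exact: pure0l.
Qed.

Lemma pure_compDl n x : {morph (pure_comp n)^~ x : b b' / b + b'}.
Proof.
move=> b b' /=; set g := gcgrad B.
set s := undup (supp g b ++ supp g b' ++ supp g (b + b')).
rewrite !(@pure_compW _ _ _ s) ?undup_uniq //; last first.
- by move=> i h; rewrite mem_undup !mem_cat h !orbT.
- by move=> i h; rewrite mem_undup !mem_cat h.
- by move=> i h; rewrite mem_undup !mem_cat h !orbT.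
by rewrite -big_split; apply: eq_bigr => i _; rewrite compD pureDl.
Qed.

Lemma pure_compDr n b : {morph pure_comp n b : x x' / x + x'}.
Proof.
move=> x x'; rewrite /pure_comp -big_split.
by apply: eq_bigr => i _; rewrite compD pureDr.
Qed.

Lemma pure_comp_homog n i j b x : gcgrad B i b -> gmgrad L j x ->
  pure_comp n b x = if i + j == n then pure b x else 0.
Proof.
move=> hb hx; set g := gcgrad B.
rewrite (@pure_compW _ _ _ (undup (i :: supp g b))) ?undup_uniq //; last first.
  by move=> k h; rewrite mem_undup inE h orbT.
rewrite (bigD1_seq i) ?undup_uniq ?mem_undup ?mem_head //= big1 ?addr0.
  rewrite (comp_homog _ hb) eqxx (comp_homog _ hx) subr_eq eq_sym [j + i]addrC.
  by case: eqP => // _; rewrite pure0r.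
by move=> k /negPf ki; rewrite (comp_homog _ hb) ki pure0l.
Qed.

Lemma pure_comp_bal n b a x : pure_comp n (b * phi a) x = pure_comp n b (a *: x).
Proof.
elim/(@homog_ind _ (gcgrad B)): b => [b b' h h'|i b hb].
  by rewrite mulrDl !pure_compDl h h'.
elim/(@homog_ind _ (gcgrad A)): a => [a a' h h'|j a ha].
  by rewrite rmorphD mulrDr scalerDl pure_compDl pure_compDr h h'.
elim/(@homog_ind _ (gmgrad L)): x => [x x' h h'|k x hx].
  by rewrite scalerDr !pure_compDr h h'.
rewrite (pure_comp_homog _ (gcM_homog hb (gchom_homog phi ha)) hx).
rewrite (pure_comp_homog _ hb (gmZ_homog ha hx)) addrA.
by rewrite pure_bal.
Qed.

Definition tens_comp (n : int) : T -> T := tens_lift (pure_comp n).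

Lemma tens_compD n : {morph tens_comp n : t u / t + u}.
Proof.
apply: tens_liftD; [exact: pure_compDl | exact: pure_compDr | exact: pure_comp_bal].
Qed.

Lemma tens_comp0 n : tens_comp n 0 = 0.
Proof. by apply: (addrI (tens_comp n 0)); rewrite -tens_compD !addr0. Qed.

Lemma tens_comp_homog n m t : tens_homog m t ->
  tens_comp n t = if m == n then t else 0.
Proof.
move=> [s [hs ->]].
rewrite (big_morph _ (tens_compD n) (tens_comp0 n)) big_seq.
have E bx : bx \in s -> tens_comp n (pure bx.1 bx.2) =
    if m == n then pure bx.1 bx.2 else 0.
  move=> /hs [i [j [hb hx ->]]]; rewrite -(pure_comp_homog n hb hx).
  apply: tens_lift_pure; [exact: pure_compDl | exact: pure_compDr |].
  exact: pure_comp_bal.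
rewrite (eq_bigr _ E); case: eqP => _; first by rewrite -big_seq.
by rewrite big1.
Qed.

Lemma tens_homog_free (s : seq int) (c : int -> T) : uniq s ->
  (forall i, tens_homog i (c i)) -> \sum_(i <- s) c i = 0 ->
  forall i, i \in s -> c i = 0.
Proof.
move=> us hc c0 i si; have := congr1 (tens_comp i) c0.
rewrite (big_morph _ (tens_compD i) (tens_comp0 i)) tens_comp0 (bigD1_seq i) //=.
rewrite (tens_comp_homog _ (hc i)) eqxx big1 ?addr0 // => j /negPf ji.
by rewrite (tens_comp_homog _ (hc j)) ji.
Qed.

Definition tens_grading : grading T := @Grading T tens_homog tens_homog0
  tens_homogB tens_homog_gen tens_homog_free.

Lemma tens_homogZ i n b t :
  gcgrad B i b -> tens_grading n t -> tens_grading (i + n) (b *: t).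
Proof.
move=> hb [s [hs ->]]; exists [seq (b * bx.1, bx.2) | bx <- s]; split.
  move=> _ /mapP[bx /hs [j [k [h1 h2 ->]]] ->] /=.
  by exists (i + j), k; rewrite addrA; split => //; apply: gcM_homog.
rewrite big_map scaler_sumr; apply: eq_bigr => bx _; exact: pureZ.
Qed.

Definition tensMod : gMod B := GMod tens_homogZ.

Definition tens1 (x : L) : tensMod := pure 1 x.

End TensorGrading.

(* Signs are integers acting by [*~].  As 0 has every degree, degrees are
   carried explicitly: [homogs g d s] says that d lists degrees of the entries
   of s. *)
Definition homogs (V : zmodType) (g : grading V) (d : seq int) (s : seq V) : Prop :=
  size d = size s /\ forall i, (i < size s)%N -> g d`_i s`_i.

Definition degsum (d : seq int) : int := \sum_(e <- d) e.

Definition perml (V : zmodType) (n : nat) (pi : 'S_n) (s : seq V) : seq V :=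
  [seq s`_(pi i) | i : 'I_n].

(* The sign alpha(pi, v) for entries of degrees d: reordering v_0, .., v_(n-1)
   into v_(pi 0), .., v_(pi (n-1)) exchanges exactly the pairs inverted by pi. *)
Definition koszul (n : nat) (pi : 'S_n) (d : seq int) : int :=
  \prod_(i < n) \prod_(j < n | (i < j)%N && (pi j < pi i)%N)
    (-1) ^ (d`_(pi i) * d`_(pi j)).

(* (l, n - l)-unshuffles, for l <= n. *)
Definition unshuffle (n l : nat) (pi : 'S_n) : bool :=
  [forall i : 'I_n, forall j : 'I_n,
    [&& (i < j)%N & (j < l)%N || (l <= i)%N] ==> (pi i < pi j)%N].

Definition graded_symmetric (U V : zmodType) (g : grading U) (F : seq U -> V) : Prop :=
  forall (d : seq int) (s : seq U) (pi : 'S_(size s)), homogs g d s ->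
    F (perml pi s) = F s *~ koszul pi d.

(* A sequence of maps F_k : L^k -> V, one for each arity k, is encoded as a
   single function on lists, F_k being its restriction to lists of length k.
   A family L^(k-1) -> End P is likewise a function seq L -> P -> P, whose k-th
   component is the restriction to lists of length k - 1. *)

Section Families.
Variables (K : fieldType) (A : gcAlg K) (L P : gMod A).

(* A-multilinearity in the L-arguments of a family of degree 1: moving a to
   the front crosses the family and the arguments before it. *)
Record graded_multilinear (D : seq L -> P -> P) : Prop := {
  gml_add : forall s1 s2 x y p,
    D (s1 ++ (x + y) :: s2) p = D (s1 ++ x :: s2) p + D (s1 ++ y :: s2) p;
  gml_scale : forall d s1 s2 e a x p,
    homogs (gmgrad L) d s1 -> gcgrad A e a ->
    D (s1 ++ (a *: x) :: s2) p =
    (a *: D (s1 ++ x :: s2) p) *~ (-1) ^ ((1 + degsum d) * e) }.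

Record endo_family (D : seq L -> P -> P) : Prop := {
  ef_linear : forall s k p q,
    D s (gcunit A k *: p + q) = gcunit A k *: D s p + D s q;
  ef_symmetric : forall p, graded_symmetric (gmgrad L) (D^~ p);
  ef_multilinear : graded_multilinear D;
  ef_degree : forall d s e p, homogs (gmgrad L) d s -> gmgrad P e p ->
    gmgrad P (1 + degsum d + e) (D s p) }.

End Families.

Definition graded_leibniz (K : fieldType) (A : gcAlg K) (n : int) (D : A -> A) : Prop :=
  forall e a b, gcgrad A e a -> D (a * b) = D a * b + (a * D b) *~ (-1) ^ (n * e).

(* [mbr] is the family X_1, X_2, ... of brackets and [msy] the family
   sigma_1, sigma_2, ... of symbols. *)
Record multider (K : fieldType) (A : gcAlg K) (L : gMod A) := Multider {
  mbr : seq L -> L;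
  msy : seq L -> A -> A;
  mbr_nil : mbr [::] = 0;
  mbr_linear : forall s1 s2 k x y,
    mbr (s1 ++ (gcunit A k *: x + y) :: s2) =
    gcunit A k *: mbr (s1 ++ x :: s2) + mbr (s1 ++ y :: s2);
  mbr_symmetric : graded_symmetric (gmgrad L) mbr;
  mbr_degree : forall d s, homogs (gmgrad L) d s ->
    gmgrad L (1 + degsum d) (mbr s);
  msy_family : @endo_family K A L (regMod A) msy;
  msy_leibniz : forall d s, homogs (gmgrad L) d s ->
    graded_leibniz (1 + degsum d) (msy s);
  mbr_leibniz : forall d s e a x, homogs (gmgrad L) d s -> gcgrad A e a ->
    mbr (rcons s (a *: x)) =
    msy s a *: x + (a *: mbr (rcons s x)) *~ (-1) ^ ((1 + degsum d) * e) }.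

Definition jacobiator (L : zmodType) (X : seq L -> L) (d : seq int) (s : seq L) : L :=
  \sum_(l < (size s).+1) \sum_(pi : 'S_(size s) | unshuffle l pi)
    (let t := perml pi s in X (X (take l t) :: drop l t)) *~ koszul pi d.

(* With k - 1 = size s, the summand i of the curvature J(D) is the one for l = i;
   the case i = k contributes nothing as there are no unshuffles in S_(k,-1). *)
Definition curvature (L P : zmodType) (X : seq L -> L) (D : seq L -> P -> P)
    (d : seq int) (s : seq L) (p : P) : P :=
  \sum_(l < (size s).+1) \sum_(pi : 'S_(size s) | unshuffle l pi)
    (let t := perml pi s in
     D (X (take l t) :: drop l t) p +
     D (take l t) (D (drop l t) p) *~ (-1) ^ degsum (take l (perml pi d)))
    *~ koszul pi d.

Record LRinf (K : fieldType) (A : gcAlg K) (L : gMod A) := LRInf {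
  lr_multider :> multider L;
  lr_J1 : forall d s, homogs (gmgrad L) d s ->
    jacobiator (mbr lr_multider) d s = 0;
  lr_J2 : forall d s a, homogs (gmgrad L) d s ->
    curvature (mbr lr_multider) (msy lr_multider) d s a = 0 }.

Record connection (K : fieldType) (A : gcAlg K) (L : gMod A) (X : multider L)
    (P : gMod A) (D : seq L -> P -> P) : Prop := {
  conn_family : endo_family D;
  conn_leibniz : forall d s e a p, homogs (gmgrad L) d s -> gcgrad A e a ->
    D s (a *: p) =
    (a *: D s p) *~ (-1) ^ ((1 + degsum d) * e) + msy X s a *: p }.

Definition flat (K : fieldType) (A : gcAlg K) (L : gMod A) (X : multider L)
    (P : gMod A) (D : seq L -> P -> P) : Prop :=
  forall d s p, homogs (gmgrad L) d s -> curvature (mbr X) D d s p = 0.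

Section Actions.
Variables (K : fieldType) (A B : gcAlg K) (phi : gcHom A B) (L : gMod A).
Variable X : LRinf L.

Record pre_action (nabla : seq L -> B -> B) : Prop := {
  pact_connection : @connection K A L X (restr phi (regMod B)) nabla;
  pact_leibniz : forall d s, homogs (gmgrad L) d s ->
    graded_leibniz (1 + degsum d) (nabla s) }.

Record action (nabla : seq L -> B -> B) : Prop := {
  act_pre : pre_action nabla;
  act_flat : @flat K A L X (restr phi (regMod B)) nabla }.

(* Y is the transformation structure of nabla on (B, B (x)_A L): by
   multilinearity and the Leibniz rule these two conditions determine Y.  The
   Jacobi identities of Y are those of X and the flatness of nabla extended to
   B (x)_A L; left connections only involve the underlying multiderivation. *)
Record transformation (nabla : seq L -> B -> B) (Y : multider (tensMod phi L)) :
    Prop := {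
  transf_msy : forall s f, msy Y [seq tens1 phi x | x <- s] f = nabla s f;
  transf_mbr : forall s,
    mbr Y [seq tens1 phi x | x <- s] = tens1 phi (mbr X s) }.

Record derivative_prerep (nabla : seq L -> B -> B) (P : gMod B)
    (D : seq L -> P -> P) : Prop := {
  dprep_connection : @connection K A L X (restr phi P) D;
  dprep_leibniz : forall d s e f p, homogs (gmgrad L) d s -> gcgrad B e f ->
    D s (f *: p) =
    (f *: D s p) *~ (-1) ^ ((degsum d + 1) * e) + nabla s f *: p }.

Definition restrict_tens1 (P : gMod B) (D : seq (tensMod phi L) -> P -> P) :
    seq L -> P -> P :=
  fun s => D [seq tens1 phi x | x <- s].

End Actions.

(* Main.v *)
(* Every homogeneous element of B (x)_A L is a sum of terms b * (1 (x) x), so a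
   B-multilinear map on B (x)_A L is determined by its values on the elements
   1 (x) x.  For the same reason the K-linearity, graded symmetry, degree and
   Leibniz conditions for a B-multilinear family only have to be checked on such
   elements, where they are the conditions for a derivative pre-representation.
   For graded symmetry, multiplying the k-th argument by b changes both sides by
   the same sign, because the Koszul sign of a permutation then changes by the
   product of the signs of moving b past the arguments preceding the k-th one in
   the original and in the permuted order.  The extension of an
   A-multilinear family is built one tensor argument at a time, through the
   universal property of the tensor product. *)

Require Import Defs.
From HB Require Import structures.
From mathcomp Require Import all_boot all_order all_algebra perm.
From mathcomp Require Import boolp classical_sets functions.
From mathcomp Require Import ring.

Set Implicit Arguments.
Unset Strict Implicit.
Unset Printing Implicit Defensive.

Import GRing.Theory.
Local Open Scope classical_set_scope.
Local Open Scope ring_scope.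

(** * Sign arithmetic and total degrees *)

Lemma signzD (m n : int) : (-1 : int) ^ (m + n) = (-1) ^ m * (-1) ^ n.
Proof. by rewrite exprzDr ?unitrN1. Qed.

Lemma signz_double (m : int) : (-1 : int) ^ (m + m) = 1.
Proof. rewrite signzD -exprzMl ?unitrN1 //. by rewrite -expr2 sqrrN expr1n exp1rz. Qed.

(** Equality of signs only depends on exponents modulo 2; naming half of the difference as [c] turns
    a sign check into a [ring] goal. *)
Lemma eq_signz (m n c : int) : m = n + (c + c) -> (-1 : int) ^ m = (-1) ^ n.
Proof. by move=> ->; rewrite signzD signz_double mulr1. Qed.

Lemma mulrz_sign (V : zmodType) (v : V) (m n : int) :
  v *~ (-1) ^ m *~ (-1) ^ n = v *~ (-1) ^ (m + n).
Proof. by rewrite signzD mulrzA. Qed.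

Lemma degsum_cat d1 d2 : degsum (d1 ++ d2) = degsum d1 + degsum d2.
Proof. exact: big_cat. Qed.

Lemma degsum_cons e d : degsum (e :: d) = e + degsum d.
Proof. exact: big_cons. Qed.

Lemma degsum_nil : degsum [::] = 0.
Proof. exact: big_nil. Qed.

(** * Lists of homogeneous elements *)

Section Homogs.
Variables (V : zmodType) (g : grading V).

Lemma homogMz i v (m : int) : g i v -> g i (v *~ m).
Proof.
move=> gv; have gMn n : g i (v *+ n).
  by elim: n => [|n IH]; rewrite ?mulrS; [exact: homog0 | exact: homogD].
by case: m => n; rewrite ?NegzE ?mulrNz; [exact: gMn | exact/homogN/gMn].
Qed.

Lemma homogs_nil : homogs g [::] [::].
Proof. by []. Qed.

Lemma homogs_consP d x s : homogs g d (x :: s) ->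
  exists e d', [/\ d = e :: d', g e x & homogs g d' s].
Proof.
case: d => [[]//|e d] [[h] k]; exists e, d; split => //; first exact: (k 0%N).
by split=> // i hi; apply: (k i.+1).
Qed.

Lemma homogs_cons e d x s : g e x -> homogs g d s -> homogs g (e :: d) (x :: s).
Proof. by move=> gx [h k]; split => [|[|i]] /=; rewrite ?h //; apply: k. Qed.

Lemma homogs_cat d1 d2 s1 s2 :
  homogs g d1 s1 -> homogs g d2 s2 -> homogs g (d1 ++ d2) (s1 ++ s2).
Proof.
elim: s1 d1 => [|x s1 IH] d1; first by case=> /size0nil ->.
case/homogs_consP=> e [d [-> gx h]] h2; exact/homogs_cons/IH.
Qed.

Lemma homogs_take k d s : homogs g d s -> homogs g (take k d) (take k s).
Proof.
case=> h1 h2; split; first by rewrite !size_take h1.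
move=> i; rewrite size_take_min leq_min => /andP[ik /h2].
by rewrite !nth_take.
Qed.

(* As 0 has every degree, the entries of a permuted list stay homogeneous
   whatever the length of the list. *)
Lemma homogs_perml n (pi : 'S_n) d s :
  homogs g d s -> homogs g (perml pi d) (perml pi s).
Proof.
case=> h1 h2; split; first by rewrite !size_map.
move=> i; rewrite size_map size_enum_ord => lin.
rewrite !(nth_map (Ordinal lin)) -?enumT ?size_enum_ord //.
set k := pi _; case: (ltnP k (size s)) => [/h2 //|hk].
by rewrite !nth_default ?h1 //; apply: homog0.
Qed.

End Homogs.

(** * Permuted lists and Koszul signs *)

Lemma size_perml (V : zmodType) n (pi : 'S_n) (s : seq V) : size (perml pi s) = n.
Proof. by rewrite size_map size_enum_ord. Qed.

Lemma nth_perml (V : zmodType) n (pi : 'S_n) (s : seq V) (i : 'I_n) :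
  (perml pi s)`_i = s`_(pi i).
Proof. by rewrite (nth_map i) ?size_enum_ord // nth_ord_enum. Qed.

(** The length of [s] is not tied to [n], so [f] must preserve the default entry 0. *)
Lemma perml_map (V W : zmodType) (f : V -> W) n (pi : 'S_n) (s : seq V) :
  f 0 = 0 -> perml pi (map f s) = map f (perml pi s).
Proof.
move=> f0; rewrite /perml -map_comp; apply: eq_map => i /=.
case: (ltnP (pi i) (size s)) => h; first by rewrite (nth_map 0).
by rewrite !nth_default ?size_map.
Qed.

(* The parts of the permuted list s1 ++ x :: s2 before and after x, for s1 of
   size k; the entry 0 stands for x, which does not occur in them. *)
Definition before (V : zmodType) n (pi : 'S_n) (k : 'I_n) (s1 s2 : seq V) :=
  take (pi^-1 k)%g (perml pi (s1 ++ 0 :: s2)).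
Definition after (V : zmodType) n (pi : 'S_n) (k : 'I_n) (s1 s2 : seq V) :=
  drop (pi^-1 k)%g.+1 (perml pi (s1 ++ 0 :: s2)).

(** Position [i] of the permuted list reads entry [pi i], so the entry at [k] lands at [pi^-1 k] and
    no other position sees it. *)
Lemma perml_cat_cons (V : zmodType) n (pi : 'S_n) (k : 'I_n) (s1 s2 : seq V) x :
  size s1 = k ->
  perml pi (s1 ++ x :: s2) = before pi k s1 s2 ++ x :: after pi k s1 s2.
Proof.
move=> sk; set j := (pi^-1 k)%g.
have st : size (before pi k s1 s2) = j by rewrite size_takel // size_perml ltnW.
apply: (@eq_from_nth _ 0).
  by rewrite size_cat st /= size_drop !size_perml subnSK ?subnKC // ltnW.
move=> i; rewrite size_perml => lin; set i' := Ordinal lin.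
rewrite -[i]/(nat_of_ord i') nth_perml [RHS]nth_cat st.
case: (ltngtP i' j) => [h|h|h].
- rewrite nth_take // nth_perml !nth_cat sk.
  case: ltngtP => // [h'|/ord_inj pik]; first by rewrite -[(_ - k)%N]prednK ?subn_gt0.
  by move: h; rewrite /j -pik permK ltnn.
- have -> : (i' - j = (i' - j).-1.+1)%N by rewrite prednK ?subn_gt0.
  rewrite /= nth_drop addSnnS prednK ?subn_gt0 // subnKC ?(ltnW h) //.
  rewrite -[i]/(nat_of_ord i') nth_perml !nth_cat sk.
  case: ltngtP => // [h'|/ord_inj pik]; first by rewrite -[(_ - k)%N]prednK ?subn_gt0.
  by move: h; rewrite /j -pik permK ltnn.
- by rewrite h subnn /= (ord_inj h) permKV nth_cat sk ltnn subnn.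
Qed.

Lemma koszulE n (pi : 'S_n) d : koszul pi d =
  (-1) ^ (\sum_(i < n) \sum_(j < n | (i < j)%N && (pi j < pi i)%N)
            d`_(pi i) * d`_(pi j)).
Proof.
rewrite /koszul (big_morph _ signzD (expr0z _)).
by apply: eq_bigr => i _; rewrite (big_morph _ signzD (expr0z _)).
Qed.

Lemma degsum_big n (d : seq int) : size d = n -> degsum d = \sum_(i < n) d`_i.
Proof. by move=> <-; rewrite /degsum (big_nth 0) big_mkord. Qed.

Lemma degsum_take (d : seq int) n (k : 'I_n) : (k <= size d)%N ->
  degsum (take k d) = \sum_(i < n | (i < k)%N) d`_i.
Proof.
move=> kd; rewrite (@degsum_big k) ?size_takel //.
rewrite (big_ord_widen _ (fun i => (take k d)`_i) (ltnW (ltn_ord k))).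
by apply: eq_bigr => i ik; rewrite nth_take.
Qed.

(* The entries forming with the one at k a pair inverted by pi are those preceding
   it in exactly one of the two orders, so modulo 2 their degrees sum to the total
   degree before it in one order plus the total degree before it in the other. *)
Lemma koszulD n (pi : 'S_n) (k : 'I_n) d1 d2 (e j : int) : size d1 = k ->
  koszul pi (d1 ++ (e + j) :: d2) =
  koszul pi (d1 ++ j :: d2) * (-1) ^ ((degsum d1 + degsum (before pi k d1 d2)) * e).
Proof.
move=> sk; set q := (pi^-1 k)%g.
have piq (i : 'I_n) : (pi i == k) = (i == q).
  by rewrite /q; apply/eqP/eqP => [<-|->]; rewrite ?permK ?permKV.
pose E (i : 'I_n) := (d1 ++ j :: d2)`_(pi i).
have E' (i : 'I_n) : (d1 ++ (e + j) :: d2)`_(pi i) = E i + (if i == q then e else 0).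
  rewrite /E !nth_cat -piq -val_eqE /= sk; case: ltngtP => [_|h|->]; rewrite ?addr0 //.
    by rewrite -[(pi i - k)%N]prednK ?subn_gt0.
  by rewrite subnn addrC.
have E0 (i : 'I_n) : i != q -> (d1 ++ 0 :: d2)`_(pi i) = E i.
  rewrite /E !nth_cat -piq -val_eqE /= sk; case: ltngtP => // h _.
  by rewrite -[(pi i - k)%N]prednK ?subn_gt0.
have degd1 : degsum d1 = \sum_(i < n) (if (pi i < k)%N then E i else 0).
  have -> : d1 = take k (d1 ++ j :: d2) by rewrite take_size_cat.
  rewrite degsum_take; last by rewrite size_cat sk leq_addr.
  by rewrite (reindex_inj (@perm_inj _ pi)) big_mkcond.
have degb : degsum (before pi k d1 d2) =
    \sum_(i < n) (if (i < q)%N then E i else 0).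
  rewrite /before degsum_take ?size_perml; last exact: ltnW.
  rewrite -big_mkcond; apply: eq_bigr => i iq; rewrite nth_perml E0 //.
  by move: iq; rewrite ltn_neqAle => /andP[].
rewrite !koszulE -signzD.
(* Entries preceding the one at [k] in both orders occur in both degree sums, hence twice; this
   correction removes them. *)
apply: (@eq_signz _ _ (- \sum_(i < n)
  (if (i < q)%N && (pi i < k)%N then e * E i else 0))).
rewrite degd1 degb.
(* The terms in [e] come from the inverted pairs containing position [q], as first or as second
   member. *)
transitivity (\sum_(i < n) \sum_(j0 < n | (i < j0)%N && (pi j0 < pi i)%N) E i * E j0
  + \sum_(i < n) (if (q < i)%N && (pi i < k)%N then e * E i else 0)
  + \sum_(i < n) (if (i < q)%N && (k < pi i)%N then e * E i else 0)).
  transitivity (\sum_(i < n) \sum_(j0 < n) (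
    (if (i < j0)%N && (pi j0 < pi i)%N then E i * E j0 else 0) +
    (if (i == q) then if (q < j0)%N && (pi j0 < k)%N then e * E j0 else 0 else 0) +
    (if (j0 == q) then if (i < q)%N && (k < pi i)%N then e * E i else 0 else 0))).
    apply: eq_bigr => i _; rewrite big_mkcond; apply: eq_bigr => l _.
    rewrite !E'; case: (eqVneq i q) => [->|iq]; case: (eqVneq l q) => [->|lq];
    rewrite ?permKV ?ltnn /=; do ?case: ifP => _; ring.
  under eq_bigr => i _ do rewrite !big_split.
  rewrite !big_split /=; congr (_ + _ + _).
  - by apply: eq_bigr => i _; rewrite [RHS]big_mkcond.
  - by rewrite exchange_big; apply: eq_bigr => i _; rewrite -big_mkcond big_pred1_eq.
  - by apply: eq_bigr => i _; rewrite -big_mkcond big_pred1_eq.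
rewrite -!addrA; congr (_ + _).
rewrite mulrDl !mulr_suml -!sumrN -!big_split /=.
apply: eq_bigr => i _; case: (eqVneq i q) => [->|iq].
  by rewrite permKV !ltnn /= mul0r !addr0.
have : (pi i : nat) != k by rewrite (inj_eq val_inj) piq.
have : (i : nat) != q by [].
case: (ltngtP i q) => // _ _; case: (ltngtP (pi i) k) => //= _ _; ring.
Qed.

(** Frees the type of [pi] from [size s], so that [s] can be rewritten without transporting the
    permutation. *)
Lemma graded_symmetricP (V W : zmodType) (g : grading V) (F : seq V -> W) :
  graded_symmetric g F <->
  forall n (pi : 'S_n) d s, size s = n -> homogs g d s ->
    F (perml pi s) = F s *~ koszul pi d.
Proof.
split=> [h n pi d s sn|h d s pi]; last exact: h.
by case: n / sn pi => pi; apply: h.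
Qed.

(** Entries are split into homogeneous components from left to right; [s1] in the proof is the
    prefix already treated. *)
Lemma homogs_list_ind (V : zmodType) (g : grading V) (Q : seq V -> Prop) :
  (forall s1 u v s2, Q (s1 ++ u :: s2) -> Q (s1 ++ v :: s2) ->
     Q (s1 ++ (u + v) :: s2)) ->
  (forall d s, homogs g d s -> Q s) -> forall s, Q s.
Proof.
move=> QD Qh s.
suff H : forall s1 d1, homogs g d1 s1 -> Q (s1 ++ s) by apply: (H [::] [::]).
elim: s => [|v s IH] s1 d1 h1; first by rewrite cats0; apply: Qh h1.
elim/(@homog_ind _ g): v => [u v|i v gv]; first exact: QD.
rewrite -cat_rcons; apply: (IH _ (d1 ++ [:: i])); rewrite -cats1.
exact/homogs_cat/homogs_cons.
Qed.

(** * Units, central scalars and commutation signs *)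

Section GradedModules.
Variables (K : fieldType) (A : gcAlg K).

Lemma homog1 : gcgrad A 0 1.
Proof. by rewrite -(rmorph1 (gcunit A)); apply: gcunit_homog. Qed.

Lemma gcunit_central k (a : A) : a * gcunit A k = gcunit A k * a.
Proof.
elim/(@homog_ind _ (gcgrad A)): a => [a b|i a ga].
  by rewrite mulrDl mulrDr => -> ->.
by rewrite (gc_comm ga (gcunit_homog A k)) mulr0 expr0z.
Qed.

Lemma scaler_comm (P : lmodType A) i j (a b : A) (p : P) :
  gcgrad A i a -> gcgrad A j b -> a *: (b *: p) = (b *: (a *: p)) *~ (-1) ^ (i * j).
Proof.
by move=> ga gb; rewrite !scalerA (gc_comm ga gb) scalerMzl.
Qed.

Lemma leibniz1 n (D : A -> A) : graded_leibniz n D -> D 1 = 0.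
Proof.
move=> lD; have := lD 0 1 1 homog1; rewrite mulr0 expr0z !mulr1 mul1r.
by move/eqP; rewrite eq_sym -subr_eq0 addrK => /eqP.
Qed.

End GradedModules.

(** * Reduction of tensors to the elements 1 (x) x *)

Section Tens.
Variables (K : fieldType) (A B : gcAlg K) (phi : gcHom A B) (L : gMod A).
Local Notation T := (tensMod phi L).
Local Notation tens1 := (@tens1 K A B phi L).

Lemma pureE b x : pure phi b x = b *: tens1 x :> T.
Proof. by have := pureZ phi b 1 x; rewrite mulr1 => /esym. Qed.

Lemma tens1D x y : tens1 (x + y) = tens1 x + tens1 y.
Proof. exact: pureDr. Qed.

Lemma tens10 : tens1 0 = 0.
Proof. exact: pure0r. Qed.

Lemma tens1Z a x : tens1 (a *: x) = phi a *: tens1 x.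
Proof. by rewrite -pureE /Defs.tens1 -pure_bal mul1r. Qed.

Lemma homog_tens1 j x : gmgrad L j x -> gmgrad T j (tens1 x).
Proof. by move=> gx; rewrite -[j]add0r; apply: tens_homog_pure => //; apply: homog1. Qed.

Lemma homogs_tens1 d s :
  homogs (gmgrad L) d s -> homogs (gmgrad T) d [seq tens1 x | x <- s].
Proof.
case=> h1 h2; split; first by rewrite size_map.
by move=> i; rewrite size_map => hi; rewrite (nth_map 0) //; apply/homog_tens1/h2.
Qed.

Lemma tens_homog_ind n (Q : T -> Prop) :
  (forall t u, gmgrad T n t -> gmgrad T n u -> Q t -> Q u -> Q (t + u)) ->
  (forall e j b x, n = e + j -> gcgrad B e b -> gmgrad L j x ->
     Q (b *: tens1 x)) ->
  forall t, gmgrad T n t -> Q t.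
Proof.
move=> QD Qp t [s [hs ->]].
suff [] : gmgrad T n (\sum_(bx <- s) pure phi bx.1 bx.2 : T)
       /\ Q (\sum_(bx <- s) pure phi bx.1 bx.2) by [].
elim: s hs => [|[b x] s IH] hs.
  rewrite big_nil; split; first exact: homog0.
  (* The empty sum is written as a generator, its scalar 0 being taken in degree [n] and its vector
     0 in degree 0. *)
  rewrite -(scale0r (tens1 0)); apply: (Qp n 0); rewrite ?addr0 //; exact: homog0.
have [i [j [hb hx nE]]] := hs (b, x) (mem_head _ _).
have [|h1 h2] := IH; first by move=> bx h; apply: hs; rewrite inE h orbT.
have hp : gmgrad T n (pure phi b x : T) by rewrite nE; apply: tens_homog_pure.
rewrite big_cons; split; first exact: homogD.
by apply: QD => //; rewrite pureE; apply: Qp nE hb hx.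
Qed.

(** The degree list is an argument of [Q] because the signs in the applications depend on it, and
    scaling an entry by [b] shifts its degree. *)
Lemma tens_list_ind (Q : seq int -> seq T -> Prop) :
  (forall d s, homogs (gmgrad L) d s -> Q d [seq tens1 x | x <- s]) ->
  (forall d1 n d2 s1 t u s2, homogs (gmgrad T) d1 s1 ->
     homogs (gmgrad T) d2 s2 -> gmgrad T n t -> gmgrad T n u ->
     Q (d1 ++ n :: d2) (s1 ++ t :: s2) -> Q (d1 ++ n :: d2) (s1 ++ u :: s2) ->
     Q (d1 ++ n :: d2) (s1 ++ (t + u) :: s2)) ->
  (forall d1 e j d2 s1 b x s2, homogs (gmgrad T) d1 s1 ->
     homogs (gmgrad T) d2 s2 -> gcgrad B e b -> gmgrad T j x ->
     Q (d1 ++ j :: d2) (s1 ++ x :: s2) ->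
     Q (d1 ++ (e + j) :: d2) (s1 ++ b *: x :: s2)) ->
  forall d s, homogs (gmgrad T) d s -> Q d s.
Proof.
move=> Q1 QD QZ d2 s2 h2.
suff H : forall d1 s1, homogs (gmgrad L) d1 s1 ->
    Q (d1 ++ d2) ([seq tens1 x | x <- s1] ++ s2) by apply: (H [::] [::]).
elim: s2 d2 h2 => [|t s2 IH] d2 h2 d1 s1 h1.
  by case: h2 => /size0nil -> _; rewrite !cats0; apply: Q1.
have [n [d [-> ht hs]]] := homogs_consP h2.
elim/tens_homog_ind: t / ht {h2} => [t u ht hu|e j b x -> hb hx].
  by apply: QD => //; apply: homogs_tens1.
apply: QZ => //; [exact: homogs_tens1 | exact: homog_tens1 |].
have := IH d hs (d1 ++ [:: j]) (s1 ++ [:: x]).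
rewrite map_cat -!catA /=; apply.
by apply: homogs_cat => //; apply: homogs_cons.
Qed.

(** * Restriction of connections and its injectivity *)

Section Connection.
Variables (X : LRinf L) (nabla : seq L -> B -> B) (act_nabla : action phi X nabla).
Variables (Y : multider T) (transf_Y : transformation X nabla Y) (P : gMod B).

(** Since [phi a] is [a] acting on 1 and the derivation [nabla s] kills 1, only the symbol term of
    the connection Leibniz rule survives. *)
Lemma action_algebra d s (a : A) : homogs (gmgrad L) d s ->
  nabla s (phi a) = phi (msy X s a).
Proof.
move=> hs; have [[con lei] _] := act_nabla.
have n1 := leibniz1 (lei d s hs).
elim/(@homog_ind _ (gcgrad A)): a => [a b|e a ga].
  have lD p q : nabla s (p + q) = nabla s p + nabla s q.
    have := ef_linear (conn_family con) s 1 p q.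
    by rewrite rmorph1 !scale1r.
  have := ef_linear (msy_family X) s 1 a b.
  rewrite rmorph1 !scale1r => -> ha hb.
  by rewrite !rmorphD /= lD ha hb.
have := conn_leibniz con (1 : B) hs ga.
rewrite n1 scaler0 mul0rz add0r => h.
by transitivity (nabla s (phi a * 1)); [rewrite mulr1|rewrite [LHS]h; apply: mulr1].
Qed.

(** Each axiom is that of [D] at the entries 1 (x) x, which keep the degree of x. For the Leibniz
    rule over A, [action_algebra] identifies the two symbols. *)
Lemma derivative_prerep_restrict D :
  connection Y D -> derivative_prerep phi X nabla (restrict_tens1 (P := P) D).
Proof.
move=> con; have [[lin sym [gadd gscale] deg] lei] := con; split; last first.
  move=> d s e f p hs hf.
  by rewrite /restrict_tens1 (lei _ _ _ _ _ (homogs_tens1 hs) hf)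
     (transf_msy transf_Y) [1 + _]addrC.
split; last first.
  move=> d s e a p hs ha; rewrite /restrict_tens1.
  have := lei _ _ _ _ p (homogs_tens1 hs) (gchom_homog phi ha).
  by rewrite (transf_msy transf_Y) (action_algebra _ hs).
split.
- move=> s k p q; rewrite /restrict_tens1.
  have := lin [seq tens1 x | x <- s] k p q.
  by rewrite -(gchom_unit phi).
- move=> p; apply/graded_symmetricP => n pi d s sn hs; rewrite /restrict_tens1.
  rewrite -(perml_map pi _ tens10); move/graded_symmetricP: (sym p); apply.
    by rewrite size_map.
  exact: homogs_tens1.
- split=> [s1 s2 x y p|d s1 s2 e a x p h1 ha]; rewrite /restrict_tens1 !map_cat /=.
    by rewrite tens1D gadd.
  by rewrite tens1Z (gscale _ _ _ _ _ _ _ (homogs_tens1 h1) (gchom_homog phi ha)).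
- by move=> d s e p hs hp; apply: deg hp; apply: homogs_tens1.
Qed.

(** Additivity and scaling, with signs depending on degrees alone, reduce every list to entries 1
    (x) x, where the two families agree. *)
Lemma graded_multilinear_inj (D D' : seq T -> P -> P) :
  graded_multilinear D -> graded_multilinear D' ->
  restrict_tens1 D = restrict_tens1 D' -> D = D'.
Proof.
move=> [gadd gscale] [gadd' gscale'] DD'; apply/funext => s; apply/funext => p.
elim/(@homogs_list_ind _ (gmgrad T)): s => [s1 u v s2|d s].
  by rewrite gadd gadd' => -> ->.
elim/tens_list_ind: d s / => [d s _|d1 n d2 s1 t u s2 _ _ _ _|].
- exact: (congr1 (fun F => F s p) DD').
- by rewrite gadd gadd' => -> ->.
- move=> d1 e j d2 s1 b x s2 h1 _ hb _ IH.
  by rewrite (gscale _ _ _ _ _ _ _ h1 hb) (gscale' _ _ _ _ _ _ _ h1 hb) IH.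
Qed.
End Connection.
End Tens.

(** * Additive maps defined degree by degree *)

Section CompMap.
Variables (V W : zmodType) (g : grading V) (F : int -> V -> W).
Hypothesis FD : forall i, {morph F i : u v / u + v}.

(** The additive map agreeing with [F i] in degree [i]; it gives degree-dependent signs a meaning on
    inhomogeneous elements. *)
Definition comp_map v := \sum_(i <- supp g v) F i (Defs.comp g v i).

Let F0 i : F i 0 = 0.
Proof. by apply: (addrI (F i 0)); rewrite -FD !addr0. Qed.

Lemma comp_mapD : {morph comp_map : u v / u + v}.
Proof.
move=> u v; set s := undup (supp g u ++ supp g v ++ supp g (u + v)).
rewrite /comp_map !(@comp_sumW _ _ _ s) ?undup_uniq //; last first.
- by move=> i h; rewrite mem_undup !mem_cat h !orbT.
- by move=> i h; rewrite mem_undup !mem_cat h.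
- by move=> i h; rewrite mem_undup !mem_cat h !orbT.
by rewrite -big_split; apply: eq_bigr => i _; rewrite compD FD.
Qed.

Lemma comp_map_homog i v : g i v -> comp_map v = F i v.
Proof.
move=> gv; rewrite /comp_map (@comp_sumW _ _ _ (undup (i :: supp g v))) ?undup_uniq //.
  rewrite (bigD1_seq i) ?undup_uniq ?mem_undup ?mem_head //= big1 ?addr0.
    by rewrite (comp_homog _ gv) eqxx.
  by move=> k /negPf ki; rewrite (comp_homog _ gv) ki.
by move=> k h; rewrite mem_undup inE h orbT.
Qed.

End CompMap.

(** The degree [m] is arbitrary because fixing a first argument of degree [j] leaves a family of
    degree [m + j], as needed for induction on the arguments. *)
Record multilinear_of_degree (K : fieldType) (A : gcAlg K) (L P : gMod A)
    (m : int) (G : seq L -> P) : Prop := {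
  mul_add : forall s1 s2 x y,
    G (s1 ++ (x + y) :: s2) = G (s1 ++ x :: s2) + G (s1 ++ y :: s2);
  mul_scale : forall d s1 s2 e a x, homogs (gmgrad L) d s1 -> gcgrad A e a ->
    G (s1 ++ (a *: x) :: s2) =
    (a *: G (s1 ++ x :: s2)) *~ (-1) ^ ((m + degsum d) * e) }.

Lemma multilinear_cons (K : fieldType) (A : gcAlg K) (L P : gMod A) m j
  (G : seq L -> P) x : multilinear_of_degree m G -> gmgrad L j x ->
  multilinear_of_degree (m + j) (fun s => G (x :: s)).
Proof.
move=> [add scale] hx; split=> [s1|d s1 s2 e a y h1 ha]; first exact: (add (x :: s1)).
by rewrite -addrA -degsum_cons; apply: (scale _ (x :: s1)) => //; apply: homogs_cons.
Qed.

(** * Extension of multilinear families to B (x)_A L *)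

Section Extension.
Variables (K : fieldType) (A B : gcAlg K) (phi : gcHom A B) (L : gMod A) (P : gMod B).
Local Notation T := (tensMod phi L).
Local Notation tens1 := (@tens1 K A B phi L).

(* The argument m is the degree of G.  Splitting b and x into homogeneous
   components makes the sign of b moving past G, and the degree of the remaining
   map G (x :: _), available without any homogeneity assumption. *)
Fixpoint extend (s : seq T) (m : int) (G : seq L -> P) : P :=
  if s is t :: s' then
    tens_lift (fun b x => comp_map (gcgrad B) (fun e b' =>
      comp_map (gmgrad L) (fun j x' =>
        (b' *: extend s' (m + j) (fun l => G (x' :: l))) *~ (-1) ^ (m * e)) x) b) t
  else G [::].

(** Termwise on the chosen representatives and components, so it can serve in proving that [extend]
    respects the tensor relations. *)
Lemma extendD s m (G G' : seq L -> P) :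
  extend s m (fun l => G l + G' l) = extend s m G + extend s m G'.
Proof.
elim: s m G G' => [//|t s IH] m G G' /=; rewrite /tens_lift -big_split.
apply: eq_bigr => -[b x] _; rewrite /comp_map /= -big_split.
apply: eq_bigr => e _ /=; rewrite -big_split.
by apply: eq_bigr => j _ /=; rewrite IH scalerDr mulrzDl.
Qed.

(** The extra sign from the degree [m + f] cancels the one from moving [c] past each scalar of the
    tensors. *)
Lemma extendZ s m f c (G : seq L -> P) : gcgrad B f c ->
  extend s (m + f) (fun l => c *: G l) = c *: extend s m G.
Proof.
move=> hc; elim: s m G => [//|t s IH] m G /=; rewrite /tens_lift scaler_sumr.
apply: eq_bigr => -[b x] _; rewrite /comp_map /= scaler_sumr.
apply: eq_bigr => e _ /=; rewrite scaler_sumr.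
apply: eq_bigr => j _ /=; rewrite [m + f + j]addrAC IH.
rewrite (scaler_comm _ (homog_comp (gcgrad B) b e) hc) mulrz_sign -scalerMzr.
by congr (_ *~ _); apply: (@eq_signz _ _ (e * f)); ring.
Qed.

(** An integer acts as a scalar of B of degree 0. *)
Lemma extendMz s m (G : seq L -> P) (z : int) :
  extend s m (fun l => G l *~ z) = extend s m G *~ z.
Proof.
transitivity (extend s (m + 0) (fun l => (1 *~ z : B) *: G l)).
  by rewrite addr0; congr extend; apply/funext => l; rewrite -scalerMzl scale1r.
by rewrite extendZ ?scalerMzl -?scalerMzl ?scale1r //; apply/homogMz/homog1.
Qed.

Section Head.
Variables (m : int) (G : seq L -> P).
Hypothesis mG : @multilinear_of_degree K A L (restr phi P) m G.
Variable s : seq T.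

Let h b x := comp_map (gcgrad B) (fun e b' =>
      comp_map (gmgrad L) (fun j x' =>
        (b' *: extend s (m + j) (fun l => G (x' :: l))) *~ (-1) ^ (m * e)) x) b.

Let inD b e j : {morph (fun x' => (b *: extend s (m + j) (fun l => G (x' :: l)))
  *~ (-1) ^ (m * e)) : x y / x + y}.
Proof.
move=> x y /=; rewrite -mulrzDl -scalerDr -extendD; congr (_ *: extend _ _ _ *~ _).
by apply/funext => l; apply: (mul_add mG [::]).
Qed.

Let outD x e : {morph (fun b' => comp_map (gmgrad L) (fun j x' =>
  (b' *: extend s (m + j) (fun l => G (x' :: l))) *~ (-1) ^ (m * e)) x) : b c / b + c}.
Proof.
move=> b c /=; rewrite /comp_map -big_split.
by apply: eq_bigr => j _ /=; rewrite scalerDl mulrzDl.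
Qed.

Let hDl x : {morph h^~ x : b c / b + c}.
Proof. exact/comp_mapD/outD. Qed.

Let hDr b : {morph h b : x y / x + y}.
Proof.
move=> x y; rewrite /h {1 2 3}/comp_map -big_split; apply: eq_bigr => e _ /=.
exact/comp_mapD/inD.
Qed.

Let h_homog e j b x : gcgrad B e b -> gmgrad L j x ->
  h b x = (b *: extend s (m + j) (fun l => G (x :: l))) *~ (-1) ^ (m * e).
Proof.
move=> hb hx; rewrite /h (comp_map_homog (outD x) hb).
by rewrite (comp_map_homog (inD b e) hx).
Qed.

(** Moving [a] out of [G] costs the sign of [m * f], which is exactly what [b * phi a], of degree
    [e + f], adds to the sign of [b]. *)
Let hbal b a x : h (b * phi a) x = h b (a *: x).
Proof.
elim/(@homog_ind _ (gcgrad B)): b => [b c /= IH IH'|e b hb].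
  by rewrite mulrDl !hDl IH IH'.
elim/(@homog_ind _ (gcgrad A)): a => [a c /= IH IH'|f a ha].
  by rewrite rmorphD mulrDr scalerDl hDl hDr IH IH'.
elim/(@homog_ind _ (gmgrad L)): x => [x y IH IH'|j x hx].
  by rewrite scalerDr !hDr IH IH'.
have hpa := gchom_homog phi ha.
rewrite (h_homog (gcM_homog hb hpa) hx) (h_homog hb (gmZ_homog ha hx)).
have -> : (fun l => G (a *: x :: l)) =
    (fun l => (phi a *: G (x :: l)) *~ (-1) ^ (m * f)).
  apply/funext => l.
  by rewrite (mul_scale mG (s1 := [::]) _ _ (homogs_nil _) ha) degsum_nil addr0.
rewrite extendMz [f + j]addrC addrA (extendZ _ _ _ hpa) -scalerMzr scalerA.
by rewrite mulrz_sign; congr (_ *~ _); congr (_ ^ _); ring.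
Qed.

Lemma extend_cons_pure e j b x : gcgrad B e b -> gmgrad L j x ->
  extend (b *: tens1 x :: s) m G =
  (b *: extend s (m + j) (fun l => G (x :: l))) *~ (-1) ^ (m * e).
Proof.
move=> hb hx; rewrite -pureE -(h_homog hb hx).
exact: (tens_lift_pure hDl hDr hbal).
Qed.

Lemma extend_consD t u :
  extend (t + u :: s) m G = extend (t :: s) m G + extend (u :: s) m G.
Proof. exact: (tens_liftD hDl hDr hbal). Qed.

Lemma extend_consZ f c t : gcgrad B f c ->
  extend (c *: t :: s) m G = (c *: extend (t :: s) m G) *~ (-1) ^ (m * f).
Proof.
move=> hc; elim/(@homog_ind _ (gmgrad T)): t => [t u IH IH'|n t ht].
  by rewrite scalerDr !extend_consD IH IH' scalerDr mulrzDl.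
elim/tens_homog_ind: t / ht => [t u _ _ IH IH'|e j b x _ hb hx].
  by rewrite scalerDr !extend_consD IH IH' scalerDr mulrzDl.
rewrite scalerA (extend_cons_pure (gcM_homog hc hb) hx) (extend_cons_pure hb hx).
rewrite -scalerMzr mulrz_sign scalerA; congr (_ *~ _); congr (_ ^ _); ring.
Qed.

End Head.

(** Induction on the prefix: a head [b *: tens1 x] is stripped, leaving degree [m + j]; commuting
    [c] with [b] supplies the missing [e] in the sign. *)
Lemma extend_multilinear m G : @multilinear_of_degree K A L (restr phi P) m G ->
  @multilinear_of_degree K B T P m (fun s => extend s m G).
Proof.
move=> mG; split=> [s1 s2 t u|d s1 s2 f c t h1 hc].
  elim: s1 m G mG => [|t1 s1 IH] m G mG; first exact: extend_consD.
  elim/(@homog_ind _ (gmgrad T)): t1 => [t1 u1 IH1 IH2|n t1 ht].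
    by rewrite !cat_cons in IH1 IH2 *; rewrite !extend_consD // IH1 IH2 addrACA.
  elim/tens_homog_ind: t1 / ht => [t1 u1 _ _ IH1 IH2|e j b x _ hb hx].
    by rewrite !cat_cons in IH1 IH2 *; rewrite !extend_consD // IH1 IH2 addrACA.
  rewrite !cat_cons !(extend_cons_pure mG _ hb hx) IH ?scalerDr ?mulrzDl //.
  exact: (multilinear_cons mG).
elim: s1 d h1 m G mG => [|t1 s1 IH] d.
  by case=> /size0nil -> _ m G mG; rewrite degsum_nil addr0; apply: extend_consZ.
case/homogs_consP=> n [d' [-> ht h1]] m G mG.
elim/tens_homog_ind: t1 / ht => [t1 u1 _ _ IH1 IH2|e j b x nE hb hx].
  by rewrite !cat_cons in IH1 IH2 *; rewrite !extend_consD // IH1 IH2 scalerDr mulrzDl.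
rewrite !cat_cons !(extend_cons_pure mG _ hb hx) (IH _ h1); last first.
  exact: (multilinear_cons mG).
rewrite -!scalerMzr (scaler_comm _ hb hc) !mulrz_sign; congr (_ *~ _).
by rewrite nE degsum_cons; apply: (@eq_signz _ _ 0); ring.
Qed.

Lemma extend_tens1 m G s : @multilinear_of_degree K A L (restr phi P) m G ->
  extend [seq tens1 x | x <- s] m G = G s.
Proof.
elim: s m G => [//|x s IH] m G mG; rewrite map_cons.
elim/(@homog_ind _ (gmgrad L)): x => [x y IHx IHy|j x hx].
  by rewrite tens1D extend_consD // IHx IHy; apply/esym/(mul_add mG [::]).
rewrite -[tens1 x]scale1r (extend_cons_pure mG _ (homog1 B) hx) mulr0 expr0z scale1r.
by apply: IH; apply: (multilinear_cons mG).
Qed.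

Lemma extension_exists (D : seq L -> P -> P) :
  @graded_multilinear K A L (restr phi P) D ->
  exists2 D' : seq T -> P -> P, graded_multilinear D' & restrict_tens1 D' = D.
Proof.
move=> [add scale].
have mD p : @multilinear_of_degree K A L (restr phi P) 1 (D^~ p) by split => *; auto.
exists (fun s p => extend s 1 (D^~ p)).
  split=> [s1 s2 x y p|d s1 s2 e a x p].
    exact: (mul_add (extend_multilinear (mD p))).
  exact: (mul_scale (extend_multilinear (mD p))).
by apply/funext => s; apply/funext => p; apply: (extend_tens1 s (mD p)).
Qed.

End Extension.

(** * Multilinear extensions of pre-representations are connections *)

Section ConnectionOfPrerep.
Variables (K : fieldType) (A B : gcAlg K) (phi : gcHom A B) (L : gMod A).
Local Notation T := (tensMod phi L).
Local Notation tens1 := (@tens1 K A B phi L).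
Variables (X : LRinf L) (nabla : seq L -> B -> B).
Variables (Y : multider T) (transf_Y : transformation X nabla Y) (P : gMod B).
Variable D : seq T -> P -> P.
Hypothesis mD : graded_multilinear D.
Hypothesis dD : derivative_prerep phi X nabla (restrict_tens1 D).

(** Scalars from K are central in B, so they pass the coefficients of the tensors without sign. *)
Lemma extension_linear s k p q :
  D s (gcunit B k *: p + q) = gcunit B k *: D s p + D s q.
Proof.
have [gadd gscale] := mD.
elim/(@homogs_list_ind _ (gmgrad T)): s => [s1 u v s2|d s].
  by rewrite !gadd => -> ->; rewrite scalerDr addrACA.
elim/tens_list_ind: d s / => [d s hs|d1 n d2 s1 t u s2 _ _ _ _|].
- have [[[lin _ _ _] _] _] := dD.
  by have := lin s k p q; rewrite /restrict_tens1 -(gchom_unit phi).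
- by rewrite !gadd => -> ->; rewrite scalerDr addrACA.
- move=> d1 e j d2 s1 b x s2 h1 _ hb _ IH.
  rewrite !(gscale _ _ _ _ _ _ _ h1 hb) IH scalerDr mulrzDl scalerMzr.
  by rewrite !scalerMzr scalerA gcunit_central -scalerA.
Qed.

Lemma extension_symmetric p : graded_symmetric (gmgrad T) (D^~ p).
Proof.
have [gadd gscale] := mD.
apply/graded_symmetricP => n pi d s sn hs; move: hs n pi sn.
elim/tens_list_ind: d s / => [d s hs|d1 m d2 s1 t u s2 _ _ _ _ IH1 IH2|].
- move=> n pi; rewrite size_map => sn; rewrite (perml_map pi _ (tens10 _ _)).
  have [[[_ sym _ _] _] _] := dD.
  by move/graded_symmetricP: (sym p); apply.
- move=> n pi; rewrite size_cat /= => sn.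
  have lk : (size s1 < n)%N by rewrite -sn addnS ltnS leq_addr.
  have := IH1 n pi; have := IH2 n pi; rewrite !size_cat /=.
  rewrite !(@perml_cat_cons _ _ pi (Ordinal lk)) // !gadd.
  by move=> -> // -> //; rewrite mulrzDl.
- move=> d1 e j d2 s1 b x s2 h1 h2 hb hx IH n pi; rewrite size_cat /= => sn.
  have lk : (size s1 < n)%N by rewrite -sn addnS ltnS leq_addr.
  have := IH n pi; rewrite size_cat /= => /(_ sn).
  rewrite !(@perml_cat_cons _ _ pi (Ordinal lk)) // => IH'.
  (* The placeholder 0 in the list of vectors is assigned the placeholder degree 0. *)
  have hv : homogs (gmgrad T) (before pi (Ordinal lk) d1 d2)
              (before pi (Ordinal lk) s1 s2).
    apply/homogs_take/homogs_perml/homogs_cat => //.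
    by apply: homogs_cons => //; apply: homog0.
  rewrite (gscale _ _ _ _ _ _ _ hv hb) (gscale _ _ _ _ _ _ _ h1 hb) IH'.
  rewrite (@koszulD _ _ (Ordinal lk)); last by case: h1.
  rewrite -scalerMzr -!mulrzA; congr (_ *~ _).
  rewrite mulrCA -signzD; congr (_ * _).
  (* [degsum d1] occurs both in the Koszul sign and in the sign of moving [b] out, and cancels
     modulo 2. *)
  by apply: (@eq_signz _ _ (- degsum d1 * e)); ring.
Qed.

Lemma extension_degree d s e p : homogs (gmgrad T) d s -> gmgrad P e p ->
  gmgrad P (1 + degsum d + e) (D s p).
Proof.
have [gadd gscale] := mD => hs hp.
elim/tens_list_ind: d s / hs => [d s hs|d1 m d2 s1 t u s2 _ _ _ _ IH1 IH2|].
- by have [[[_ _ _ deg] _] _] := dD; apply: deg.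
- by rewrite gadd; apply: homogD.
- move=> d1 f j d2 s1 b x s2 h1 _ hb _ IH.
  rewrite (gscale _ _ _ _ _ _ _ h1 hb).
  have -> : 1 + degsum (d1 ++ (f + j) :: d2) + e =
            f + (1 + degsum (d1 ++ j :: d2) + e).
    by rewrite !degsum_cat !degsum_cons; ring.
  apply: homogMz; exact: gmZ_homog.
Qed.

(** The symbol [msy Y] is B-multilinear too, so both sides scale alike; the sign from exchanging [b]
    and [f] matches the degree that [b] adds to [s]. *)
Lemma extension_leibniz d s e f p : homogs (gmgrad T) d s -> gcgrad B e f ->
  D s (f *: p) =
  (f *: D s p) *~ (-1) ^ ((1 + degsum d) * e) + msy Y s f *: p.
Proof.
have [gadd gscale] := mD => hs hf.
have [yadd yscale] := ef_multilinear (msy_family Y).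
elim/tens_list_ind: d s / hs => [d s hs|d1 m d2 s1 t u s2 _ _ _ _ IH1 IH2|].
- have [_ lei] := dD.
  by rewrite (transf_msy transf_Y) [1 + _]addrC; apply: lei.
- by rewrite !gadd yadd IH1 IH2 scalerDr scalerDl mulrzDl addrACA.
- move=> d1 j i d2 s1 b x s2 h1 _ hb _ IH.
  rewrite !(gscale _ _ _ _ _ _ _ h1 hb) (yscale _ _ _ _ _ _ _ h1 hb) IH.
  rewrite scalerDr mulrzDl; congr (_ + _); last first.
    by rewrite -scalerMzl scalerA.
  rewrite -!scalerMzr (scaler_comm _ hb hf) -!mulrzA -!signzD; congr (_ *~ _).
  apply: (@eq_signz _ _ 0); rewrite !degsum_cat !degsum_cons; ring.
Qed.

Lemma extension_connection : connection Y D.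
Proof.
split; last exact: extension_leibniz.
split => //; [exact: extension_linear | exact: extension_symmetric |].
exact: extension_degree.
Qed.
End ConnectionOfPrerep.

(** * The bijection, with multilinear extension as its inverse *)

Theorem proposition59 (K : fieldType) (charK : [pchar K] =i pred0)
    (A : gcAlg K) (L : gMod A) (X : LRinf L)
    (B : gcAlg K) (phi : gcHom A B)
    (nabla : seq L -> B -> B) (act_nabla : action phi X nabla)
    (Y : multider (tensMod phi L)) (transf_Y : transformation X nabla Y)
    (P : gMod B) :
  set_bij [set D : seq (tensMod phi L) -> P -> P | connection Y D]
          [set D : seq L -> P -> P | derivative_prerep phi X nabla D]
          (@restrict_tens1 K A B phi L P) /\
  (forall (D : seq L -> P -> P) (D' : seq (tensMod phi L) -> P -> P),
     derivative_prerep phi X nabla D -> restrict_tens1 D' = D ->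
     (graded_multilinear D' <-> connection Y D')).
Proof.
have multi (D' : seq (tensMod phi L) -> P -> P) :
    connection Y D' -> graded_multilinear D'.
  by move=> con; apply: ef_multilinear (conn_family con).
split; last first.
  move=> D D' dD eD; split; last exact: multi.
  by move=> mD; apply: (extension_connection transf_Y mD); rewrite eD.
split.
- move=> D con; exact: (derivative_prerep_restrict act_nabla transf_Y con).
- move=> D D'; rewrite !inE /= => /multi mD /multi mD'.
  exact: graded_multilinear_inj.
- move=> D /= dD; have [[[_ _ mD _] _] _] := dD.
  have [D' mD' eD] := extension_exists mD; exists D' => //=.
  by apply: (extension_connection transf_Y mD'); rewrite eD.
Qed.
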